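(* Let $\boldsymbol\alpha=(\alpha_1,\dots,\alpha_d)$, $\boldsymbol\beta=(\beta_1,\dots,\beta_d)$ be multisets of rational numbers, disjoint modulo $\mathbb{Z}$, with common denominator $N$, and let $q$ be a prime power with $(q-1)\alpha_i,(q-1)\beta_j\in\mathbb{Z}$. Define $$\lambda=-\min_{x\in[0,1],\ \gcd(k,N)=1}\Lambda(k\boldsymbol\alpha,k\boldsymbol\beta,x),\qquad \Lambda(\boldsymbol\alpha,\boldsymbol\beta,x)=\sum_{i=1}^d\big(\{x+\alpha_i\}-\{\alpha_i\}+\{-x-\beta_i\}-\{-\beta_i\}\big).$$ Then for every $t\in\mathbb{F}_q^\times$, $q^{\lambda}H_q(\boldsymbol\alpha,\boldsymbol\beta|t)$ is an algebraic integer.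
   Context: $\{x\}$ is the fractional part; $k\boldsymbol\alpha=(k\alpha_1,\dots,k\alpha_d)$. Fix a nontrivial additive character $\psi_q$ of $\mathbb{F}_q$, a generator $\omega$ of the character group of $\mathbb{F}_q^\times$, $g(m)=\sum_{x\in\mathbb{F}_q^\times}\omega(x)^m\psi_q(x)$, $\bar q=q-1$, and $$H_q(\boldsymbol\alpha,\boldsymbol\beta|t)=\frac{1}{1-q}\sum_{m=0}^{q-2}\prod_{i=1}^d\frac{g(m+\alpha_i\bar q)\,g(-m-\beta_i\bar q)}{g(\alpha_i\bar q)\,g(-\beta_i\bar q)}\,\omega((-1)^dt)^m .$$ *)

(* Defs.v *)
From HB Require Import structures.
From mathcomp Require Import all_boot all_order all_algebra all_field all_character.
Set Implicit Arguments. Unset Strict Implicit. Unset Printing Implicit Defensive.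
Import Order.TTheory GRing.Theory Num.Theory.
Local Open Scope ring_scope.

Definition frac (x : rat) : rat := x - (Num.floor x)%:~R.

Definition Lambda (d : nat) (a b : 'I_d -> rat) (x : rat) : rat :=
  \sum_(i < d) (frac (x + a i) - frac (a i) + frac (- x - b i) - frac (- b i)).

Definition commonDen (d : nat) (a b : 'I_d -> rat) : nat :=
  \big[lcmn/1%N]_(i < d) lcmn (`|denq (a i)|%N) (`|denq (b i)|%N).

Definition isMinLambda (d : nat) (a b : 'I_d -> rat) (m : rat) : Prop :=
  let N := commonDen a b in
  (exists (k : int) (x : rat), [/\ coprimez k (N%:Z), 0 <= x <= 1 &
      Lambda (fun i => k%:~R * a i) (fun i => k%:~R * b i) x = m]) /\
  (forall (k : int) (x : rat), coprimez k (N%:Z) -> 0 <= x <= 1 ->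
      m <= Lambda (fun i => k%:~R * a i) (fun i => k%:~R * b i) x).

Definition addChar (F : finFieldType) (psi : F -> algC) : Prop :=
  [/\ psi 0 = 1, (forall x y, psi (x + y) = psi x * psi y) & exists x, psi x != 1].

(* generator of the character group of F^x (cyclic of order q-1):
   a multiplicative character whose order is exactly q - 1 *)
Definition genMulChar (F : finFieldType) (om : F -> algC) : Prop :=
  [/\ om 1 = 1,
      (forall x y, x != 0 -> y != 0 -> om (x * y) = om x * om y) &
      forall k : nat, (forall x : F, x != 0 -> om x ^+ k = 1) -> (#|F|.-1 %| k)%N].

Definition gauss (F : finFieldType) (psi om : F -> algC) (m : int) : algC :=
  \sum_(x : F | x != 0) (om x) ^ m * psi x.

(* the integer (q-1) * a, for a with (q-1) a in Z *)
Definition qbarMul (F : finFieldType) (a : rat) : int :=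
  Num.floor ((#|F|.-1)%:R * a).

Definition Hq (F : finFieldType) (psi om : F -> algC) (d : nat)
    (a b : 'I_d -> rat) (t : F) : algC :=
  (1 - (#|F|)%:R)^-1 *
  \sum_(m < #|F|.-1)
    ((\prod_(i < d)
        (gauss psi om (m%:Z + qbarMul F (a i)) * gauss psi om (- m%:Z - qbarMul F (b i))
         / (gauss psi om (qbarMul F (a i)) * gauss psi om (- qbarMul F (b i)))))
     * om ((-1) ^+ d * t) ^+ m).

(* Main.v *)
Require Import Defs.
From HB Require Import structures.
From mathcomp Require Import all_boot all_order all_algebra all_field all_character.
From mathcomp Require Import cyclic ring zify.
Set Implicit Arguments. Unset Strict Implicit. Unset Printing Implicit Defensive.
Import Order.TTheory GRing.Theory Num.Theory.
Local Open Scope ring_scope.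

(** Write [T m] for the [m]-th product of Gauss sums in [Hq], [Q = q - 1] and
    [q = p ^ f].

    Away from [p] the only denominator of [Hq] is [1 - q], because [g(n)] divides
    [q]; and [1 - q] divides the sum, because expanding the Gauss sums turns it
    into a combination of the sums over [m] of [om x ^+ m], each [0] or [Q].  So
    some [q ^+ n * Hq] is integral, and as [q] and [1 - q] are coprime it remains
    to see that every [q ^+ lam * T m] is integral.

    This is local at the primes above [p], where the lower half of Stickelberger's
    theorem suffices: since [g(n) g(-n)] is [q] up to sign, a lower bound for
    the valuation of [g(-n)] is an upper bound for that of [g(n)].  The lower bound
    [v(g(c p^i)) >= {c/Q} + {p c/Q} + ... + {p^(f-1) c/Q}] (with [v(q) = f])
    follows by induction on [c]: if [p] divides [c], pass to [c / p] and [i + 1];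
    otherwise [g((c-1) p^i) g(p^i) = J g(c p^i)] for a Jacobi sum [J] which reduces
    to [-c], hence is a local unit, and fractional parts are subadditive.  The
    exponents for [T m] then add up to values of [Lambda]. *)

(** Substituting ['X^n] into the minimal polynomial of [x ^+ n] gives a monic integer polynomial
    that kills [x]. *)
Lemma Aint_rootX (n : nat) (x : algC) : (0 < n)%N -> x ^+ n \in Aint -> x \in Aint.
Proof.
move=> n_gt0 xnA.
apply: (@root_monic_Aint (minCpoly (x ^+ n) \Po 'X^n)).
- by rewrite /root horner_comp hornerXn -/(root _ _) root_minCpoly.
- rewrite monicE lead_coef_comp ?size_polyXn //.
  by rewrite (monicP (minCpoly_monic _)) lead_coefXn expr1n mulr1.
- by rewrite polyOver_comp // polyOverXn.
Qed.

(** * Multiplicative characters, Jacobi sums and Gauss sums *)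

(** The target is any field, since Jacobi sums occur both in [algC] and, after reduction, in [F]
    itself. The value at 0 is unconstrained, so all sums avoid 0. *)
Definition mulChar (F : finFieldType) (R : fieldType) (chi : F -> R) : Prop :=
  chi 1 = 1 /\ (forall x y, x != 0 -> y != 0 -> chi (x * y) = chi x * chi y).

Section MulChar.
Variables (F : finFieldType) (R : fieldType).
Implicit Types (chi : F -> R) (x y : F).

Lemma mulChar_neq0 chi x : mulChar chi -> x != 0 -> chi x != 0.
Proof.
move=> [chi1 chiM] x0; apply/eqP => cx0; have := chiM x x^-1 x0.
by rewrite invr_eq0 x0 divff // chi1 cx0 mul0r => /(_ isT)/eqP; rewrite oner_eq0.
Qed.

Lemma mulCharV chi x : mulChar chi -> x != 0 -> chi x^-1 = (chi x)^-1.
Proof.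
move=> chiP x0; apply: (mulfI (mulChar_neq0 chiP x0)).
by rewrite divff ?mulChar_neq0 // -(chiP.2) ?invr_eq0 // divff // chiP.1.
Qed.

Lemma mulCharX chi x n : mulChar chi -> x != 0 -> chi (x ^+ n) = chi x ^+ n.
Proof.
move=> [chi1 chiM] x0; elim: n => [|n IHn]; first by rewrite !expr0.
by rewrite !exprS chiM ?IHn // expf_neq0.
Qed.

Lemma mulCharN1 chi : mulChar chi -> chi (-1) = 1 \/ chi (-1) = -1.
Proof.
move=> chiP; have := mulCharX 2 chiP (_ : -1 != 0); rewrite oppr_eq0 oner_eq0 => /(_ isT).
rewrite sqrrN expr1n chiP.1 => /esym/eqP; rewrite sqrf_eq1 => /orP[]/eqP; by [left|right].
Qed.

Lemma mulChar_expz chi (m : int) : mulChar chi -> mulChar (fun x => chi x ^ m).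
Proof.
by move=> [chi1 chiM]; split=> [|x y x0 y0]; rewrite ?chi1 ?exp1rz // chiM // expfzMl.
Qed.

Lemma sum_mulChar0 chi y : mulChar chi -> y != 0 -> chi y != 1 ->
  \sum_(x | x != 0) chi x = 0.
Proof.
move=> chiP y0 cy1; apply/eqP; set s := \sum_(x | _) _.
have Ds : s = chi y * s.
  rewrite mulr_sumr {1}/s (reindex_onto (fun x => y * x) (fun x => y^-1 * x)) /=; last first.
    by move=> x _; rewrite mulVKf.
  under eq_bigl => x do rewrite mulKf // eqxx andbT mulf_eq0 (negPf y0) /=.
  by apply: eq_bigr => x x0; rewrite chiP.2.
have: (1 - chi y) * s == 0 by rewrite mulrBl mul1r -Ds subrr.
by rewrite mulf_eq0 subr_eq0 eq_sym (negPf cy1).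
Qed.

Definition jacobiSum chi1 chi2 : R :=
  \sum_(x | (x != 0) && (x != 1)) chi1 x * chi2 (1 - x).

End MulChar.

Lemma addChar_sum0 (F : finFieldType) (psi : F -> algC) :
  addChar psi -> \sum_x psi x = 0.
Proof.
move=> [psi0 psiD [y py1]]; apply/eqP; set s := \sum_x _.
have Ds : s = psi y * s.
  rewrite mulr_sumr {1}/s (reindex_inj (addrI y)) /=.
  by apply: eq_bigr => x _; rewrite psiD.
have: (1 - psi y) * s == 0 by rewrite mulrBl mul1r -Ds subrr.
by rewrite mulf_eq0 subr_eq0 eq_sym (negPf py1).
Qed.

Lemma addChar_sum_neq0 (F : finFieldType) (psi : F -> algC) :
  addChar psi -> \sum_(x | x != 0) psi x = -1.
Proof.
move=> psiP; have := addChar_sum0 psiP; rewrite (bigD1 0) //=.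
by case: psiP => -> _ _ /eqP; rewrite addrC addr_eq0 => /eqP.
Qed.

Definition gaussSum (F : finFieldType) (psi chi : F -> algC) : algC :=
  \sum_(x | x != 0) chi x * psi x.

(** Sort the pairs [(x, y)] by [s = x + y]. For [s != 0], scaling by [s] splits off the Jacobi sum;
    the pairs with [s = 0] give the last term, which survives only when the product character is
    trivial. *)
Lemma gaussSumM (F : finFieldType) (psi chi1 chi2 : F -> algC) :
    addChar psi -> mulChar chi1 -> mulChar chi2 ->
  gaussSum psi chi1 * gaussSum psi chi2 =
    jacobiSum chi1 chi2 * gaussSum psi (fun x => chi1 x * chi2 x)
    + chi2 (-1) * \sum_(x | x != 0) chi1 x * chi2 x.
Proof.
move=> [psi0 psiD _] c1P c2P; rewrite /gaussSum mulr_suml.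
transitivity (\sum_(x | x != 0) \sum_(s | s != x) chi1 x * chi2 (s - x) * psi s).
  apply: eq_bigr => x x0; rewrite mulr_sumr (reindex_inj (addIr (- x))) /=.
  apply: eq_big => s; rewrite ?subr_eq0 // => sx.
  by rewrite mulrACA -psiD subrKC.
rewrite (exchange_big_dep predT) //= (bigD1 0) //= addrC; congr (_ + _); last first.
  rewrite mulr_sumr; apply: eq_big => x; first by rewrite eq_sym andbb.
  move=> /andP[x0 _]; rewrite psi0 mulr1 sub0r -(mulN1r x) c2P.2 ?oppr_eq0 ?oner_eq0 //.
  by rewrite mulrCA.
rewrite mulr_sumr; apply: eq_bigr => s s0.
rewrite /jacobiSum mulr_suml (reindex_onto (fun x => s * x) (fun x => s^-1 * x)) /=; last first.
  by move=> x _; rewrite mulVKf.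
apply: eq_big => x.
  rewrite mulKf // eqxx andbT mulf_eq0 (negPf s0) /= -{1}(mulr1 s).
  by rewrite (inj_eq (mulfI s0)) [1 == x]eq_sym.
rewrite mulKf // eqxx andbT mulf_eq0 (negPf s0) /= -{1}(mulr1 s).
rewrite (inj_eq (mulfI s0)) [1 == x]eq_sym => /andP[x0 x1].
have x1s : 1 - x != 0 by rewrite subr_eq0 eq_sym.
rewrite -{2}(mulr1 s) -mulrBr !c1P.2 ?c2P.2 //.
by ring.
Qed.

(** The summand is [chi (x / (1 - x))], and [x / (1 - x)] takes every value except 0 and -1. So this
    is a full character sum, which vanishes, without its term at -1. *)
Lemma jacobiSumV (F : finFieldType) (R : fieldType) (chi : F -> R) (y : F) :
    mulChar chi -> y != 0 -> chi y != 1 ->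
  jacobiSum chi (fun x => (chi x)^-1) = - chi (-1).
Proof.
move=> cP y0 cy1.
transitivity (\sum_(x | (x != 0) && (x != -1)) chi x).
  rewrite /jacobiSum (reindex_onto (fun x => x / (1 + x)) (fun x => x / (1 - x))) /=.
    have N0 (x : F) : x != -1 -> 1 + x != 0 by rewrite addrC addr_eq0.
    apply: eq_big => x.
      (* Since [0^-1 = 0], the substitution sends -1 to 0, which the range of summation excludes. *)
      have [->|x1] := eqVneq x (-1).
        by rewrite subrr invr0 mulr0 eqxx andbF.
      have x10 := N0 x x1.
      have D: 1 - x / (1 + x) = (1 + x)^-1 by field.
      rewrite D invrK divfK // eqxx !andbT mulf_eq0 invr_eq0 (negPf x10) orbF.
      by rewrite -[_ == 1]subr_eq0 -opprB D oppr_eq0 invr_eq0 x10 andbT.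
    move=> /andP[/andP[]].
    have [->|x1] := eqVneq x (-1); first by rewrite subrr invr0 mulr0 eqxx.
    have x10 := N0 x x1.
    have D: 1 - x / (1 + x) = (1 + x)^-1 by field.
    rewrite D mulf_eq0 negb_or invr_eq0 x10 andbT => x0 _ _.
    by rewrite cP.2 ?invr_eq0 // mulCharV // invrK divfK // mulChar_neq0.
  move=> x /andP[x0 x1]; have x10: 1 - x != 0 by rewrite subr_eq0 eq_sym.
  have -> : 1 + x / (1 - x) = (1 - x)^-1 by field.
  by rewrite invrK divfK.
have := sum_mulChar0 cP y0 cy1; rewrite (bigD1 (-1)) ?oppr_eq0 ?oner_eq0 //=.
by move=> /eqP; rewrite addrC addr_eq0 => /eqP.
Qed.

(** In [gaussSumM] the Jacobi sum is [- chi (-1)], the trivial Gauss sum is -1 and the remaining sum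
    is [q - 1]; these add up to [chi (-1) * q]. The element [y] witnesses that [chi] is
    nontrivial. *)
Lemma gaussSumV (F : finFieldType) (psi chi : F -> algC) (y : F) :
    addChar psi -> mulChar chi -> y != 0 -> chi y != 1 ->
  gaussSum psi chi * gaussSum psi (fun x => (chi x)^-1) = chi (-1) * #|F|%:R.
Proof.
move=> pP cP y0 cy1.
have cVP : mulChar (fun x => (chi x)^-1).
  by split=> [|u v u0 v0]; rewrite ?cP.1 ?invr1 // cP.2 // invfM.
rewrite gaussSumM // (jacobiSumV cP y0 cy1) /gaussSum.
have E (f : F -> algC) : \sum_(x | x != 0) chi x * (chi x)^-1 * f x = \sum_(x | x != 0) f x.
  by apply: eq_bigr => x x0; rewrite divff ?mul1r // mulChar_neq0.
rewrite E addChar_sum_neq0 //.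
have -> : \sum_(x | x != 0) chi x / chi x = #|F|%:R - 1.
  under eq_bigr => x do rewrite -[_ / _]mulr1.
  rewrite E sumr_const.
  have -> : #|[pred x : F | x != 0]| = #|F|.-1 by rewrite (cardC1 0).
  by rewrite -(@subn1 #|F|) natrB // (cardD1 0).
have -> : (chi (-1))^-1 = chi (-1).
  by case: (mulCharN1 cP) => ->; rewrite ?invrN invr1.
ring.
Qed.

(** * The Stickelberger exponents *)

(* [stick p f n] is [Q * ({n/Q} + {p n/Q} + ... + {p^(f-1) n/Q})], i.e. [Q / (p - 1)]
   times the sum of the base [p] digits of [n mod Q]. *)
Definition stick (p f : nat) (n : int) : nat :=
  \sum_(j < f) `|((p ^ j)%N%:Z * n %% (p ^ f).-1%:Z)%Z|%N.

Section Stick.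
Variables p f : nat.
Hypotheses (p_pr : prime p) (f_gt0 : (0 < f)%N).
Local Notation Q := (p ^ f).-1.

Lemma pf_gt1 : (1 < p ^ f)%N.
Proof. by rewrite -(expn0 p) ltn_exp2l ?prime_gt1. Qed.

Lemma Q_gt0 : (0 < Q)%N.
Proof. by have := pf_gt1; case: (p ^ f)%N => [|[]]. Qed.

Lemma QS : Q.+1 = (p ^ f)%N.
Proof. by rewrite prednK // expn_gt0 prime_gt0. Qed.

Lemma coprime_Qp j : coprime Q (p ^ j).
Proof.
apply: coprimeXr; rewrite coprime_sym prime_coprime //; apply/negP => pQ.
have : (p %| Q.+1)%N by rewrite QS dvdn_exp.
rewrite -addn1 dvdn_addr ?dvdn1 // => /eqP p1; by move: p_pr; rewrite p1.
Qed.

Lemma eq_stick m n : (m = n %[mod Q])%Z -> stick p f m = stick p f n.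
Proof. by move=> mn; apply: eq_bigr => j _; rewrite -modzMmr mn modzMmr. Qed.

Lemma stick0 : stick p f 0 = 0%N.
Proof. by rewrite /stick big1 // => j _; rewrite mulr0 mod0z. Qed.

(** As [p ^ f] is 1 modulo [Q], multiplication by [p] permutes the summands cyclically. *)
Lemma stickMp n : stick p f (p%:Z * n) = stick p f n.
Proof.
have E : ((p ^ f)%N%:Z * n = n %[mod Q])%Z.
  have -> : (p ^ f)%N%:Z = Q%:Z + 1 by have := QS; lia.
  by rewrite mulrDl mul1r [_ * n]mulrC modzMDl.
rewrite /stick; case: f f_gt0 E => // g _ E; rewrite big_ord_recr big_ord_recl /= addnC.
congr (_ + _)%N; last first.
  by apply: eq_bigr => j _; rewrite mulrA -PoszM mulnC -expnS.
by rewrite mulrA -PoszM mulnC -expnS E expn0 mul1r.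
Qed.

Lemma absz_modD (m n d : int) : 0 < d ->
  (`|(m + n) %% d|%Z <= `|m %% d|%Z + `|n %% d|%Z)%N.
Proof.
move=> d0; have d1 : d != 0 by rewrite gt_eqF.
have m0 := modz_ge0 m d1; have n0 := modz_ge0 n d1.
rewrite -modzDm; set s := (m %% d)%Z + _.
have s0 : 0 <= s by rewrite addr_ge0.
have sd : (s %/ d)%Z * d >= 0 by rewrite mulr_ge0 ?divz_ge0 // ltW.
have := divz_eq s d; have := modz_ge0 s d1; move: sd m0 n0 s0; rewrite /s.
lia.
Qed.

Lemma stickD m n : (stick p f (m + n) <= stick p f m + stick p f n)%N.
Proof.
rewrite /stick -big_split /=; apply: leq_sum => j _; rewrite mulrDr.
by apply: absz_modD; rewrite ltz_nat Q_gt0.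
Qed.

(** This is the geometric sum of the [p ^ j], which are already reduced modulo [Q]; for [Q = 1] all
    residues would be 0. *)
Lemma stick1 : (1 < Q)%N -> (p.-1 * stick p f 1 = Q)%N.
Proof.
move=> Q1; rewrite predn_exp /stick; congr (_ * _)%N; apply: eq_bigr => j _.
rewrite mulr1 modz_small //= ltz_nat; apply: (@leq_ltn_trans (p ^ f.-1)).
  by rewrite leq_exp2l ?prime_gt1 // -ltnS prednK.
move: Q1; rewrite -subn1; case: f f_gt0 => // g _ /=; rewrite expnS.
have := prime_gt1 p_pr; have : (0 < p ^ g)%N by rewrite expn_gt0 prime_gt0.
nia.
Qed.

(** Each [p ^ j * n] is nonzero modulo [Q], so its residue and that of its opposite add up to [Q].
    This mirrors [g(n) g(-n)] being [q] up to sign. *)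
Lemma stickN n : ~~ (Q%:Z %| n)%Z -> (stick p f n + stick p f (- n) = f * Q)%N.
Proof.
move=> Qn; rewrite /stick -big_split /=.
have -> : (f * Q = \sum_(j < f) Q)%N by rewrite sum_nat_const card_ord.
apply: eq_bigr => j _; rewrite mulrN.
have : ~~ (Q%:Z %| (p ^ j)%N%:Z * n)%Z by rewrite Gauss_dvdzr //; apply: coprime_Qp.
set m := _ * n => Qm.
have d0 : Q%:Z != 0 by rewrite eqz_nat -lt0n Q_gt0.
have E : (- m = - 1 * Q%:Z + (Q%:Z - (m %% Q)%Z) %[mod Q])%Z.
  rewrite modzMDl modzDl modzNm //.
have m0 : 0 < (m %% Q)%Z.
  by rewrite lt_neqAle modz_ge0 // andbT eq_sym; apply: contra Qm => /eqP/dvdz_mod0P.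
have m1 : (m %% Q)%Z < Q by rewrite ltz_pmod // ltz_nat Q_gt0.
rewrite E modzMDl; move: (m %% Q)%Z m0 m1 => r.
by move: Q => q r0 r1; clear -r0 r1; rewrite modz_small; lia.
Qed.

Lemma stick_frac n :
  (stick p f n)%:R = Q%:R * \sum_(j < f) Defs.frac ((p ^ j)%:R * (n%:~R / Q%:R)) :> rat.
Proof.
rewrite /stick natr_sum mulr_sumr; apply: eq_bigr => j _.
have Q0 : (Q%:R : rat) != 0 by rewrite pnatr_eq0 -lt0n Q_gt0.
have d0 : Q%:Z != 0 by rewrite eqz_nat -lt0n Q_gt0.
rewrite mulrA; set m := (p ^ j)%N%:Z * n.
have -> : (p ^ j)%:R * n%:~R = m%:~R :> rat by rewrite intrM -pmulrn.
have -> : `|(m %% Q)%Z|%N%:R = (m %% Q)%Z%:~R :> rat.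
  by rewrite -[in RHS](gez0_abs (modz_ge0 m d0)) -pmulrn.
have Dm : m%:~R = (m %/ Q)%Z%:~R * Q%:R + (m %% Q)%Z%:~R :> rat.
  by rewrite [in LHS](divz_eq m Q) intrD intrM -pmulrn.
have -> : Defs.frac (m%:~R / Q%:R) = m%:~R / Q%:R - (m %/ Q)%Z%:~R.
  rewrite /Defs.frac (@floor_def _ _ (m %/ Q)%Z) //.
  have Qp : 0 < (Q%:R : rat) by rewrite ltr0n Q_gt0.
  rewrite ler_pdivlMr // ltr_pdivrMr // Dm lerDl ler0z modz_ge0 //=.
  rewrite intrD mulrDl mul1r ltrD2l.
  by rewrite -[Q%:R]/(Q%:Z%:~R) ltr_int ltz_pmod // ltz_nat Q_gt0.
by rewrite Dm; field.
Qed.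

End Stick.

(** * Generators of the character group and their Gauss sums *)

Section FiniteField.
Variable F : finFieldType.
Local Notation Q := #|F|.-1.

Lemma finField_card_gt0 : (0 < Q)%N.
Proof. by have := finNzRing_gt1 F; case: #|F| => [|[]]. Qed.

Lemma finField_expQ (x : F) : x != 0 -> x ^+ Q = 1.
Proof.
move=> x0; apply: (mulfI x0); rewrite mulr1 -exprS prednK ?expf_card //.
exact: ltnW (finNzRing_gt1 F).
Qed.

Lemma finField_prim_root : {w : F | Q.-primitive_root w}.
Proof.
suff /hasP/sig2W[w _ pw] : has Q.-primitive_root (enum [pred x : F | x != 0]) by exists w.
apply: has_prim_root finField_card_gt0 _ _ _.
- by apply/allP => x; rewrite mem_enum => x0; apply/unity_rootP/finField_expQ.
- exact: enum_uniq.
- by rewrite -cardE (cardC1 0).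
Qed.

Lemma finField_exp (w x : F) : Q.-primitive_root w -> x != 0 -> {n : nat | x = w ^+ n}.
Proof.
by move=> pw /finField_expQ/(prim_rootP pw)[n ->]; exists n.
Qed.

Lemma prim_root_neq0 (R : fieldType) n (w : R) : n.-primitive_root w -> w != 0.
Proof.
by move=> pw; rewrite (prim_root_eq0 pw) -lt0n (prim_order_gt0 pw).
Qed.

Lemma finField_card_pexp : {pf : nat * nat | [/\ prime pf.1, pf.1 \in [pchar F],
  (0 < pf.2)%N & #|F| = (pf.1 ^ pf.2)%N]}.
Proof.
have [p p_pr pF] := finPcharP F.
have E := card_pprimeChar pF.
exists (p, logn p #|F|); split=> //=.
rewrite lt0n; apply/eqP => l0; have := finNzRing_gt1 F.
by rewrite E l0.
Qed.

Variable om : F -> algC.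
Hypothesis omP : genMulChar om.

Lemma genMulChar_mulChar : mulChar om.
Proof. by case: omP. Qed.

Lemma genMulChar_expQ (x : F) : x != 0 -> om x ^+ Q = 1.
Proof.
move=> x0; rewrite -mulCharX ?finField_expQ //; last exact: genMulChar_mulChar.
exact: genMulChar_mulChar.1.
Qed.

(** All values of [om] are powers of [om w], so the order of [om w] kills every value and
    [genMulChar] makes it a multiple of [Q]. *)
Lemma genMulChar_prim (w : F) : Q.-primitive_root w -> Q.-primitive_root (om w).
Proof.
move=> pw; have w0 := prim_root_neq0 pw.
have [m pm mQ] := prim_order_exists finField_card_gt0 (genMulChar_expQ w0).
suff -> : Q = m by [].
apply/eqP; rewrite eqn_dvd mQ andbT; case: omP => _ _; apply=> x x0.
have [n ->] := finField_exp pw x0.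
by rewrite (mulCharX n genMulChar_mulChar w0) exprAC (prim_expr_order pm) expr1n.
Qed.

Lemma genMulChar_neq0 (x : F) : x != 0 -> om x != 0.
Proof. exact/mulChar_neq0/genMulChar_mulChar. Qed.

Lemma genMulChar_expz_eq1 (w : F) (m : int) :
  Q.-primitive_root w -> (om w ^ m == 1) = (Q%:Z %| m)%Z.
Proof.
move=> pw; have pz := genMulChar_prim pw; case: m => n.
  by rewrite -exprnP -(prim_order_dvd pz).
by rewrite NegzE -exprnN dvdzE /= invr_eq1 -(prim_order_dvd pz).
Qed.

Lemma eq_gauss (psi : F -> algC) m n : (m = n %[mod Q])%Z ->
  gauss psi om m = gauss psi om n.
Proof.
move=> /eqP; rewrite eqz_mod_dvd => /dvdzP[k] mn.
apply: eq_bigr => x x0; congr (_ * _).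
rewrite -[m](subrK n) mn expfzDr ?genMulChar_neq0 // mulrC -exprz_exp exprzAC.
by rewrite -[om x ^ Q]/(om x ^+ Q) genMulChar_expQ // exp1rz mulr1.
Qed.

Lemma gaussSum_expz (psi : F -> algC) (m : int) :
  gauss psi om m = gaussSum psi (fun x => om x ^ m).
Proof. by []. Qed.

Lemma genMulChar_expz_Aint (m : int) x : x != 0 -> om x ^ m \in Aint.
Proof.
move=> x0; apply: (Aint_unity_root finField_card_gt0); apply/unity_rootP.
rewrite -[_ ^+ Q]/((om x ^ m) ^ Q) exprzAC.
by rewrite -[om x ^ Q]/(om x ^+ Q) genMulChar_expQ // exp1rz.
Qed.

Lemma gauss0 (psi : F -> algC) m : addChar psi -> (Q%:Z %| m)%Z -> gauss psi om m = -1.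
Proof.
move=> psiP /dvdz_mod0P m0; rewrite (@eq_gauss _ m 0) ?m0 ?mod0z //.
rewrite -(addChar_sum_neq0 psiP); apply: eq_bigr => x _.
by rewrite expr0z mul1r.
Qed.

(** The sign is the value of the character at -1; it is left open because divisibility ignores
    it. *)
Lemma gaussN (psi : F -> algC) m : addChar psi -> ~~ (Q%:Z %| m)%Z ->
  gauss psi om m * gauss psi om (- m) = #|F|%:R \/
  gauss psi om m * gauss psi om (- m) = - #|F|%:R.
Proof.
move=> psiP m0; have [w pw] := finField_prim_root.
have mP := mulChar_expz m genMulChar_mulChar.
have := gaussSumV psiP mP (prim_root_neq0 pw).
rewrite genMulChar_expz_eq1 // => /(_ m0).
have -> : gaussSum psi (fun x => (om x ^ m)^-1) = gauss psi om (- m).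
  by apply: eq_bigr => x x0; rewrite invr_expz.
rewrite -gaussSum_expz => ->.
by case: (mulCharN1 mP) => /= ->; rewrite ?mul1r ?mulN1r; [left|right].
Qed.

Lemma gauss_Aint (psi : F -> algC) m : (forall x, psi x \in Aint) ->
  gauss psi om m \in Aint.
Proof.
by move=> psiA; apply: rpred_sum => x x0; rewrite rpredM ?genMulChar_expz_Aint.
Qed.

End FiniteField.

(** * Additive characters and the first divisibility of Gauss sums *)

Lemma addChar_pexp (F : finFieldType) (psi : F -> algC) p x :
  p \in [pchar F] -> addChar psi -> psi x ^+ p = 1.
Proof.
move=> pF [psi0 psiD _]; rewrite -psi0 -(mulrn_pchar pF x).
by elim: p {pF} => [|n IHn]; rewrite ?expr0 ?mulr0n // exprS IHn mulrS psiD.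
Qed.

Lemma addChar_Aint (F : finFieldType) (psi : F -> algC) x :
  addChar psi -> psi x \in Aint.
Proof.
move=> psiP; have [p p_pr pF] := finPcharP F.
apply: (Aint_unity_root (prime_gt0 p_pr)); apply/unity_rootP.
exact: addChar_pexp psiP.
Qed.

(** With [h = e - 1], expand [(1 + h) ^+ p = 1] and divide by [h]: the middle binomial coefficients
    are divisible by [p], hence so is [h ^+ p.-1]. *)
Lemma pth_root_sub1_Aint p (e : algC) : prime p -> e ^+ p = 1 ->
  (e - 1) ^+ p.-1 / p%:R \in Aint.
Proof.
move=> p_pr ep1; set h := e - 1.
have p0 : (p%:R : algC) != 0 by rewrite pnatr_eq0 -lt0n prime_gt0.
have [h0|h0] := eqVneq h 0.
  rewrite h0 expr0n; case: p p_pr {ep1 p0} => [|[|p]] //= _.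
  by rewrite mul0r.
have hA : h \in Aint.
  rewrite rpredB ?Aint1 //; apply: (Aint_unity_root (prime_gt0 p_pr)).
  exact/unity_rootP.
have := ep1; rewrite -(subrK 1 e) -/h addrC exprDn.
case: p p_pr p0 {ep1} => // n p_pr p0.
rewrite big_ord_recr big_ord_recl /= binn bin0 subnn !expr0 !expr1n !mulr1 !mulr1n mul1r.
under eq_bigr => i _ do rewrite expr1n mul1r /bump /= add1n.
move=> /eqP; rewrite -addrA -subr_eq0 addrAC subrr add0r.
have -> : \sum_(i < n) h ^+ i.+1 *+ 'C(n.+1, i.+1) =
    h * (n.+1%:R * \sum_(i < n) h ^+ i *+ ('C(n.+1, i.+1) %/ n.+1)).
  rewrite !mulr_sumr; apply: eq_bigr => i _.
  have /divnK Dc : (n.+1 %| 'C(n.+1, i.+1))%N.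
    by rewrite prime_dvd_bin //= ltnS ltn_ord.
  rewrite -{1}Dc; set c := (_ %/ _)%N.
  by rewrite -[h ^+ i *+ c]mulr_natr -[LHS]mulr_natr natrM exprS; ring.
rewrite exprS -mulrDr mulf_eq0 (negPf h0) /= addrC addr_eq0 => /eqP ->.
rewrite mulNr rpredN mulrAC divff // mul1r.
by apply: rpred_sum => i _; rewrite rpredMn // rpredX.
Qed.

(** A nontrivial [chi] has sum 0, so [psi x] may be replaced by [psi x - 1], which is divisible by
    [rho]: take [p.-1]-th powers. *)
Lemma gaussSum_uniformizer_Aint (F : finFieldType) (psi chi : F -> algC) p (rho : algC) y :
    prime p -> p \in [pchar F] -> addChar psi -> mulChar chi ->
    (forall x, x != 0 -> chi x \in Aint) -> y != 0 -> chi y != 1 -> rho ^+ p.-1 = p%:R ->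
  gaussSum psi chi / rho \in Aint.
Proof.
move=> p_pr pF psiP cP cA y0 cy1 Drho.
have -> : gaussSum psi chi = \sum_(x | x != 0) chi x * (psi x - 1).
  under [RHS]eq_bigr => x _ do rewrite mulrBr mulr1.
  by rewrite sumrB (sum_mulChar0 cP y0 cy1) subr0.
rewrite mulr_suml; apply: rpred_sum => x x0; rewrite -mulrA rpredM ?cA //.
apply: (@Aint_rootX p.-1); first by case: p p_pr {pF Drho} => [|[]].
rewrite exprMn exprVn Drho pth_root_sub1_Aint //.
exact: addChar_pexp psiP.
Qed.

(** * Testing integrality at the primes above [p] *)

(* A prime above [p] is represented by a pair of primitive [Q]-th roots of unity, [w]
   in [F] and [z] in [algC]: the elements of [Z[z]] outside it are the [hornerz u z]
   with [hornerz u w != 0]. *)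
Definition hornerz (R : comNzRingType) (u : {poly int}) (x : R) : R :=
  (map_poly intr u).[x].

Section Hornerz.
Variable R : comNzRingType.
Implicit Types (u v : {poly int}) (x : R).

Lemma hornerzC c x : hornerz c%:P x = c%:~R.
Proof. by rewrite /hornerz map_polyC hornerC. Qed.
Lemma hornerz0 x : hornerz 0 x = 0.
Proof. exact: hornerzC. Qed.
Lemma hornerz1 x : hornerz 1 x = 1.
Proof. exact: hornerzC. Qed.
Lemma hornerzXn n x : hornerz 'X^n x = x ^+ n.
Proof. by rewrite /hornerz map_polyXn hornerXn. Qed.
Lemma hornerzD u v x : hornerz (u + v) x = hornerz u x + hornerz v x.
Proof. by rewrite /hornerz rmorphD hornerD. Qed.
Lemma hornerzB u v x : hornerz (u - v) x = hornerz u x - hornerz v x.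
Proof. by rewrite /hornerz rmorphB hornerD hornerN. Qed.
Lemma hornerzM u v x : hornerz (u * v) x = hornerz u x * hornerz v x.
Proof. by rewrite /hornerz rmorphM hornerM. Qed.
Lemma hornerzX u n x : hornerz (u ^+ n) x = hornerz u x ^+ n.
Proof. by rewrite /hornerz rmorphXn horner_exp. Qed.
Lemma hornerz_comp_Xn u n x : hornerz (u \Po 'X^n) x = hornerz u (x ^+ n).
Proof. by rewrite /hornerz map_comp_poly map_polyXn horner_comp hornerXn. Qed.
Lemma hornerz_prod I r (P : pred I) (u : I -> {poly int}) x :
  hornerz (\prod_(i <- r | P i) u i) x = \prod_(i <- r | P i) hornerz (u i) x.
Proof. by rewrite /hornerz rmorph_prod horner_prod. Qed.
Lemma hornerz_sum I r (P : pred I) (u : I -> {poly int}) x :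
  hornerz (\sum_(i <- r | P i) u i) x = \sum_(i <- r | P i) hornerz (u i) x.
Proof. by rewrite /hornerz rmorph_sum horner_sum. Qed.

End Hornerz.

Lemma hornerz_Aint u (x : algC) : x \in Aint -> hornerz u x \in Aint.
Proof.
by move=> xA; apply: rpred_horner => //; apply/polyOverP => i; rewrite coef_map Aint_int.
Qed.

Lemma coprime_modinv j Q : (0 < Q)%N -> coprime j Q ->
  exists2 k, coprime k Q & (j * k = 1 %[mod Q])%N.
Proof.
move=> Q0 cjQ; have [j0|j_gt0] := posnP j.
  move: cjQ; rewrite j0 /coprime gcd0n => /eqP ->; by exists 1%N.
have [k l E _] := egcdnP Q j_gt0; move: cjQ E; rewrite /coprime => /eqP -> E.
exists k; last by rewrite mulnC E modnMDl.
rewrite /coprime -dvdn1 -(dvdn_addr _ (_ : gcdn k Q %| l * Q)%N).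
  by rewrite -E dvdn_mulr // dvdn_gcdl.
by rewrite dvdn_mull // dvdn_gcdr.
Qed.

Lemma prim_root_sum0 (R : fieldType) n (z : R) e d : n.-primitive_root z ->
  (n %| e * d)%N -> ~~ (n %| e)%N -> \sum_(i < d) z ^+ (e * i) = 0.
Proof.
move=> pz ned ne; have := subrX1 (z ^+ e) d.
rewrite -exprM (eqP (_ : z ^+ (e * d) == 1)) -?(prim_order_dvd pz) // subrr.
move/esym/eqP; rewrite mulf_eq0 subr_eq0 -(prim_order_dvd pz) (negPf ne) /= => /eqP.
by under eq_bigr => i _ do rewrite -exprM.
Qed.

Section LocalCriterion.
Variables (F : finFieldType) (p : nat).
Hypothesis pF : p \in [pchar F].
Local Notation Q := #|F|.-1.

(** The remainder of [v] modulo ['X^Q - 1] has the same values at all these points. Reduced modulo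
    [p], it has [Q] distinct roots and fewer than [Q] as degree, so all its coefficients are
    divisible by [p]. *)
Lemma hornerz_vanish (v : {poly int}) (w : F) (z : algC) :
    Q.-primitive_root w -> Q.-primitive_root z ->
    (forall j : 'I_Q, hornerz v (w ^+ j) = 0) ->
  exists2 r : algC, r \in Aint & hornerz v z = p%:R * r.
Proof.
move=> pw pz v0; pose D : {poly int} := 'X^Q - 1.
have Q0 := prim_order_gt0 pw.
have D_mon : D \is monic by rewrite monicXnsubC.
have hD (R : comNzRingType) (x : R) : x ^+ Q = 1 -> hornerz D x = 0.
  by move=> xQ; rewrite hornerzB hornerzXn hornerz1 xQ subrr.
set r := Pdiv.CommonRing.rmodp v D.
have Dv : v = Pdiv.CommonRing.rdivp v D * D + r by apply: Pdiv.RingMonic.rdivp_eq.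
have hr (R : comNzRingType) (x : R) : x ^+ Q = 1 -> hornerz v x = hornerz r x.
  by move=> xQ; rewrite Dv hornerzD hornerzM hD // mulr0 add0r.
have sz_r : (size r <= Q)%N.
  rewrite -ltnS -(size_XnsubC (1 : int) Q0) -/D.
  exact: Pdiv.CommonRing.ltn_rmodpN0 (monic_neq0 D_mon).
have r0 : map_poly intr r = 0 :> {poly F}.
  apply/eqP; apply: contraLR sz_r => r0; rewrite -ltnNge.
  have := @max_poly_roots _ _ [seq w ^+ (j : 'I_Q) | j <- enum 'I_Q] r0 _ _.
  rewrite size_map size_enum_ord => H; apply: leq_trans (H _ _) (size_poly _ _).
    apply/allP => _ /mapP[j _ ->]; rewrite /root -/(hornerz r _).
    have wjQ : (w ^+ j) ^+ Q = 1 by rewrite exprAC (prim_expr_order pw) expr1n.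
    by rewrite -hr ?v0.
  rewrite map_inj_in_uniq ?enum_uniq // => i j _ _ /eqP.
  rewrite (eq_prim_root_expr pw) !modn_small // => /eqP; exact: val_inj.
rewrite hr ?prim_expr_order //.
exists (hornerz (\poly_(i < size r) (r`_i %/ p)%Z) z).
  exact/hornerz_Aint/(Aint_prim_root pz).
rewrite pmulrn -(hornerzC _ z) -hornerzM; congr (hornerz _ z).
apply/polyP => i; rewrite coefCM coef_poly.
case: ltnP => [_|/(nth_default 0) ->]; last by rewrite mulr0.
rewrite mulrC divzK // (dvdz_pcharf pF).
by have /polyP/(_ i) := r0; rewrite coef_map coef0 => ->.
Qed.

(** Writing 1 as [(1 - p r) + p r] removes one power of [p] at a time. *)
Lemma Aint_of_coprime_p n (r y : algC) : r \in Aint -> (1 - p%:R * r) * y \in Aint ->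
  p%:R ^+ n * y \in Aint -> y \in Aint.
Proof.
move=> rA ryA; elim: n => [|n IHn]; first by rewrite expr0 mul1r.
move=> pyA; apply: IHn.
have -> : p%:R ^+ n * y = p%:R ^+ n * ((1 - p%:R * r) * y) + r * (p%:R ^+ n.+1 * y).
  by rewrite exprS; ring.
by rewrite rpredD // rpredM // rpredX // Aint_Cnat.
Qed.

(* The multipliers [u k] of all the primes above [p] combine to one that is [1] modulo
   [p]. The exponents [j] not coprime to [Q] correspond to no prime, and get a
   multiplier which vanishes at [z]. *)
Lemma Aint_local n (w : F) (z y : algC) :
    Q.-primitive_root w -> Q.-primitive_root z -> p%:R ^+ n * y \in Aint ->
    (forall k, coprime k Q ->
       exists2 u, hornerz u w != 0 & hornerz u (z ^+ k) * y \in Aint) ->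
  y \in Aint.
Proof.
move=> pw pz pyA loc; have Q0 := prim_order_gt0 pw.
have /fin_all_exists2[u uw uz] (j : 'I_Q) :
    exists2 u, hornerz u (w ^+ j) != 0 & hornerz u z * y \in Aint.
  have [cjQ|ncjQ] := boolP (coprime j Q).
    have [k ckQ jk] := coprime_modinv Q0 cjQ; have [u uw uz] := loc k ckQ.
    (* With [j k = 1] modulo [Q], composing with ['X^k] carries [w ^+ j] to [w] and [z] to
       [z ^+ k]. *)
    exists (u \Po 'X^k); rewrite hornerz_comp_Xn //.
    by rewrite -exprM -(prim_expr_mod pw) jk (prim_expr_mod pw) expr1.
  pose d := gcdn j Q; pose e := (Q %/ d)%N.
  have dQ : (d %| Q)%N by apply: dvdn_gcdr.
  have d0 : (0 < d)%N by rewrite gcdn_gt0 Q0 orbT.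
  have ed : (e * d = Q)%N by rewrite divnK.
  (* At [w ^+ j] every term is 1, and the sum [d] is nonzero in [F] since it divides [Q]. At [z] it
     is a geometric sum of ratio [z ^+ e != 1] over a full period. *)
  exists (\sum_(i < d) 'X^(e * i)).
    rewrite hornerz_sum (eq_bigr (fun=> 1)) => [|i _].
      by rewrite sumr_const card_ord (prim_root_dvd_eq0 pw dQ).
    rewrite hornerzXn -exprM mulnA; apply/eqP; rewrite exprM -(expr1n _ i); apply/eqP.
    congr (_ ^+ i); apply/eqP; rewrite -(prim_order_dvd pw).
    by rewrite -[X in (X %| _)%N]ed mulnC dvdn_mul // dvdn_gcdl.
  rewrite hornerz_sum (eq_bigr (fun i : 'I_d => z ^+ (e * i))) => [|i _]; last first.
    by rewrite hornerzXn.
  have e_gt0 : (0 < e)%N by rewrite divn_gt0 // dvdn_leq.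
  have eQ : (e < Q)%N.
    by rewrite ltn_Pdiv // ltn_neqAle d0 andbT eq_sym; exact: ncjQ.
  have Qed : (Q %| e * d)%N by rewrite ed.
  have Qe : ~~ (Q %| e)%N by rewrite gtnNdvd.
  by rewrite (prim_root_sum0 pz Qed Qe) mul0r rpred0.
(* Every [w ^+ j] is a root of [v], as nonzero elements of [F] have [Q]-th power 1; hence [p]
   divides [v] at [z]. On the other side, [1 - v] lies in the ideal generated by the [u j]. *)
pose v := \prod_(j < Q) (1 - u j ^+ Q).
have [r rA vr] : exists2 r : algC, r \in Aint & hornerz v z = p%:R * r.
  apply: hornerz_vanish pw pz _ => j; rewrite hornerz_prod (bigD1 j) //=.
  by rewrite hornerzB hornerz1 hornerzX finField_expQ // subrr mul0r.
apply: (Aint_of_coprime_p rA) pyA; rewrite -vr hornerz_prod.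
suff [] : hornerz 1 z \in Aint /\ (1 - \prod_(j < Q) hornerz (1 - u j ^+ Q) z) * y \in Aint by [].
pose P x := x \in Aint /\ (1 - x) * y \in Aint.
split; first by rewrite hornerz1.
suff: P (\prod_(j < Q) hornerz (1 - u j ^+ Q) z) by case.
apply: big_ind => [|a b [aA ayA] [bA byA]|j _].
- by split; rewrite // subrr mul0r.
- split; first exact: rpredM.
  have -> : (1 - a * b) * y = b * ((1 - a) * y) + (1 - b) * y by ring.
  by rewrite rpredD // rpredM.
split; first exact/hornerz_Aint/(Aint_prim_root pz).
rewrite hornerzB hornerz1 hornerzX subKr -(prednK Q0) exprSr -mulrA.
by rewrite rpredM ?rpredX ?hornerz_Aint ?(Aint_prim_root pz).
Qed.

End LocalCriterion.

(** * Jacobi sums with values in the residue field *)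

Section JacobiMod.
Variable F : finFieldType.
Local Notation Q := #|F|.-1.

Lemma mulChar_expV (n : nat) : mulChar (fun x : F => x^-1 ^+ n).
Proof.
by split=> [|x y x0 y0]; rewrite ?invr1 ?expr1n // invfM exprMn.
Qed.

Lemma sum_expV (n : nat) : ~~ (Q %| n)%N ->
  \sum_(x : F | (x != 0) && (x != 1)) x^-1 ^+ n = -1.
Proof.
move=> Qn; have [w pw] := finField_prim_root F.
have := @sum_mulChar0 F F _ w (mulChar_expV n) (prim_root_neq0 pw).
rewrite exprVn invr_eq1 -(prim_order_dvd pw) => /(_ Qn).
rewrite (bigD1 1) ?oner_eq0 //= invr1 expr1n => /eqP.
by rewrite addrC addr_eq0 => /eqP.
Qed.

(** Induction on [c]. In the difference of consecutive sums the factor [1 - x ^+ (p ^ i)] is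
    [(1 - x) ^+ (p ^ i)] by Frobenius and cancels the second character, leaving a power sum equal to
    -1. *)
Lemma jacobiSum_expV p i c : p \in [pchar F] -> coprime Q (p ^ i) ->
    (1 < Q)%N -> (c < Q)%N ->
  jacobiSum (fun x : F => x^-1 ^+ (p ^ i * c)) (fun x => x^-1 ^+ (p ^ i)) = - c.+1%:R.
Proof.
move=> pF Qp Q1; elim: c => [|c IHc] cQ.
  rewrite muln0 /jacobiSum; under eq_bigr => x _ do rewrite expr0 mul1r.
  rewrite (reindex_inj (inv_inj (subKr (1 : F)))) /=.
  under eq_bigr => x _ do rewrite subKr.
  rewrite -(@sum_expV (p ^ i)).
    apply: eq_bigl => x; rewrite andbC; congr (~~ _ && ~~ _).
      by rewrite -subr_eq0 addrAC subrr add0r oppr_eq0.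
    by rewrite subr_eq0 eq_sym.
  apply/negP => /gcdn_idPl; move: Qp; rewrite /coprime => /eqP -> Q1'.
  by rewrite -Q1' in Q1.
suff : jacobiSum (fun x : F => x^-1 ^+ (p ^ i * c.+1)) (fun x => x^-1 ^+ (p ^ i))
     - jacobiSum (fun x : F => x^-1 ^+ (p ^ i * c)) (fun x => x^-1 ^+ (p ^ i)) = -1.
  rewrite IHc; last exact: ltnW.
  by move=> /eqP; rewrite subr_eq => /eqP ->; rewrite -opprD -[c.+2]add1n natrD.
rewrite /jacobiSum -sumrB -(@sum_expV (p ^ i * c.+1)); last first.
  by rewrite Gauss_dvdr // gtnNdvd.
apply: eq_bigr => x /andP[x0 x1].
have x10 : 1 - x != 0 by rewrite subr_eq0 eq_sym.
have E : (1 - x) ^+ (p ^ i) = 1 - x ^+ (p ^ i).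
  have pn : [pchar F].-nat (p ^ i)%N by rewrite pnatX pnatE ?(pcharf_prime pF) // pF.
  have := exprDn_pchar (1 - x) x pn; rewrite subrK expr1n => D.
  by apply/esym/eqP; rewrite subr_eq; apply/eqP.
have -> : x^-1 ^+ (p ^ i * c) = x^-1 ^+ (p ^ i * c.+1) * x ^+ (p ^ i).
  rewrite mulnS exprD mulrAC -exprMn mulVf // expr1n mul1r //.
rewrite -mulrBl -{1}[x^-1 ^+ _]mulr1 -mulrBr -E -mulrA -exprMn divff // expr1n mulr1 //.
Qed.

End JacobiMod.

(** * The lower bound of Stickelberger at one prime *)

Section LocalBound.
Variables (F : finFieldType) (p f : nat).
Hypotheses (p_pr : prime p) (pF : p \in [pchar F]) (f_gt0 : (0 < f)%N).
Hypothesis cardF : #|F| = (p ^ f)%N.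
Local Notation Q := #|F|.-1.
Variables (psi om : F -> algC) (theta : algC) (w : F).
Hypotheses (psiP : addChar psi) (omP : genMulChar om).
Hypotheses (thetaP : theta ^+ Q = p%:R) (pw : Q.-primitive_root w).

Lemma theta_neq0 : theta != 0.
Proof.
apply/eqP => t0; have /eqP := thetaP; rewrite t0 expr0n gtn_eqF ?finField_card_gt0 //.
by rewrite eq_sym pnatr_eq0 gtn_eqF ?prime_gt0.
Qed.

Lemma theta_Aint : theta \in Aint.
Proof. by apply: (@Aint_rootX Q); rewrite ?finField_card_gt0 // thetaP Aint_Cnat. Qed.

(** Reduction from [Z[om w]] to [F] sending [om w] to [w^-1], kept as a relation so that no
    well-definedness is at stake. Then [om x] reduces to [x^-1], the normalisation in which the
    digits of [n], not of [- n], govern [g(n)]. *)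
Let redu (z : algC) (r : F) : Prop :=
  exists2 u, hornerz u (om w) = z & hornerz u w^-1 = r.

Let redu_sum (I : finType) (P : pred I) (z : I -> algC) (r : I -> F) :
  (forall i, P i -> redu (z i) (r i)) ->
  redu (\sum_(i | P i) z i) (\sum_(i | P i) r i).
Proof.
move=> zr; apply: (big_ind2 redu) => //; first by exists 0; rewrite hornerz0.
by move=> _ _ _ _ [u <- <-] [v <- <-]; exists (u + v); rewrite hornerzD.
Qed.

Let redu_om x : x != 0 -> redu (om x) x^-1.
Proof.
move=> x0; have [n ->] := finField_exp pw x0.
exists 'X^n; rewrite hornerzXn ?exprVn //.
by rewrite mulCharX //; [apply: genMulChar_mulChar|apply: prim_root_neq0 pw].
Qed.

Lemma jacobiSum_reduction (a b : nat) : exists2 u,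
  hornerz u (om w) = jacobiSum (fun x => om x ^ a) (fun x => om x ^ b) &
  hornerz u w^-1 = jacobiSum (fun x : F => x^-1 ^+ a) (fun x => x^-1 ^+ b).
Proof.
apply: redu_sum => x /andP[x0 x1]; have x10 : 1 - x != 0 by rewrite subr_eq0 eq_sym.
have [u <- <-] := redu_om x0; have [v <- <-] := redu_om x10.
by exists (u ^+ a * v ^+ b); rewrite hornerzM !hornerzX.
Qed.

(* [theta] has valuation [1 / Q] when [p] has valuation [1]. *)
Lemma gauss_local_bound_pexp c i : (c < Q)%N -> exists2 u, hornerz u w^-1 != 0 &
  hornerz u (om w) * gauss psi om (p ^ i * c)%N / theta ^+ stick p f c \in Aint.
Proof.
have psiA x : psi x \in Aint by apply: addChar_Aint.
have Qp j : coprime Q (p ^ j) by rewrite cardF; apply: coprime_Qp.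
have t0 := theta_neq0.
elim/ltn_ind: c i => c IHc i cQ.
have [c0|c_gt0] := posnP c.
  exists 1; rewrite !hornerz1 ?oner_eq0 // c0 stick0 expr0 divr1 mul1r.
  exact: gauss_Aint.
have Q1 : (1 < Q)%N by apply: leq_ltn_trans cQ.
have [c1|cn1] := eqVneq c 1%N.
  (* The uniformizer is [theta ^+ stick p f 1]: by [stick1] its [p.-1]-th power is
     [theta ^+ Q = p]. *)
  exists 1; rewrite !hornerz1 ?oner_eq0 // c1 muln1 mul1r.
  apply: (gaussSum_uniformizer_Aint p_pr pF psiP _ _ (prim_root_neq0 pw)).
  - exact/mulChar_expz/genMulChar_mulChar.
  - by move=> x x0; apply: genMulChar_expz_Aint.
  - rewrite (genMulChar_expz_eq1 omP) // dvdzE /=; apply/negP => /gcdn_idPl.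
    by move: (Qp i); rewrite /coprime => /eqP -> Q1'; rewrite -Q1' in Q1.
  by rewrite -exprM mulnC stick1 -?cardF.
have [/dvdnP[c' Dc]|pc] := boolP (p %| c)%N.
  have c'c : (c' < c)%N.
    rewrite Dc ltn_Pmulr ?prime_gt1 //; by move: c_gt0; rewrite Dc muln_gt0 => /andP[].
  have [u uw uA] := IHc c' c'c i.+1 (ltn_trans c'c cQ).
  exists u => //; rewrite Dc [(c' * p)%N]mulnC mulnA -expnSr PoszM [Posz (p * c')]PoszM.
  by rewrite stickMp // -PoszM.
case: c => // c in IHc cQ c_gt0 cn1 pc *.
have {cn1}c_gt1 : (0 < c)%N by rewrite lt0n; apply: contra cn1 => /eqP ->.
have [u1 u1w u1A] := IHc c (ltnSn c) i (ltnW cQ).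
have [u2 u2w u2A] := IHc 1%N c_gt1 i Q1.
(* The exponent is now [c.+1]; this Jacobi sum reduces to [- c.+1%:R], nonzero because [p] does not
   divide [c.+1]. *)
have [uJ uJz uJw] := jacobiSum_reduction (p ^ i * c) (p ^ i).
exists (uJ * u1 * u2).
  rewrite !hornerzM !mulf_neq0 // uJw jacobiSum_expV ?(ltnW cQ) // oppr_eq0.
  by rewrite -(dvdn_pcharf pF).
have JE : hornerz uJ (om w) * gauss psi om (p ^ i * c.+1)%N =
    gauss psi om (p ^ i * c)%N * gauss psi om (p ^ i * 1)%N.
  have omM := genMulChar_mulChar omP.
  rewrite !gaussSum_expz gaussSumM //; try exact: mulChar_expz.
  rewrite muln1 uJz.
  have DM x : x != 0 -> om x ^ (p ^ i * c)%N * om x ^ (p ^ i)%N = om x ^ (p ^ i * c.+1)%N.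
    by move=> x0; rewrite -[RHS]/(om x ^+ _) mulnS addnC exprD.
  (* The extra term of [gaussSumM] vanishes: [0 < c.+1 < Q] and [p] is prime to [Q], so the product
     character is nontrivial. *)
  have -> : \sum_(x | x != 0) om x ^ (p ^ i * c)%N * om x ^ (p ^ i)%N = 0.
    under eq_bigr => x x0 do rewrite DM //.
    apply: (sum_mulChar0 (mulChar_expz _ omM) (prim_root_neq0 pw)).
    by rewrite (genMulChar_expz_eq1 omP) // dvdzE /= Gauss_dvdr // gtnNdvd.
  rewrite mulr0 addr0; congr (_ * _); apply: eq_bigr => x x0; by rewrite DM.
have Sc : (stick p f c.+1 <= stick p f c + stick p f 1)%N.
  by rewrite -addn1 PoszD; apply: stickD.
rewrite !hornerzM.
set A := hornerz u1 (om w) in u1A *; set B := hornerz u2 (om w) in u2A *.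
(* The bounds for [c] and 1 multiply to the one for [c.+1], up to a surplus power of [theta] whose
   exponent is a true difference by [Sc]. *)
have -> : hornerz uJ (om w) * A * B * gauss psi om (p ^ i * c.+1)%N / theta ^+ stick p f c.+1 =
  (A * gauss psi om (p ^ i * c)%N / theta ^+ stick p f c) *
  (B * gauss psi om (p ^ i * 1)%N / theta ^+ stick p f 1) *
  theta ^+ (stick p f c + stick p f 1 - stick p f c.+1).
  have -> : hornerz uJ (om w) * A * B * gauss psi om (p ^ i * c.+1)%N =
    (hornerz uJ (om w) * gauss psi om (p ^ i * c.+1)%N) * A * B by ring.
  rewrite JE expfB_cond.
    rewrite exprD; field.
    by rewrite !expf_neq0.
  by rewrite (negPf t0).
by rewrite rpredM ?rpredX ?theta_Aint // rpredM.
Qed.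

Lemma gauss_local_bound (n : int) : exists2 u, hornerz u w^-1 != 0 &
  hornerz u (om w) * gauss psi om n / theta ^+ stick p f n \in Aint.
Proof.
have Q0 : 0 < Q%:Z by rewrite ltz_nat finField_card_gt0.
have n0 : 0 <= (n %% Q)%Z by rewrite modz_ge0 // gt_eqF.
have nQ : (n %% Q)%Z < Q by rewrite ltz_pmod.
have E : n = `|(n %% Q)%Z|%N %[mod Q]%Z by rewrite gez0_abs // modz_mod.
have cQ : (`|(n %% Q)%Z| < Q)%N by rewrite -ltz_nat gez0_abs.
have [u uw uA] := gauss_local_bound_pexp 0 cQ; exists u => //.
rewrite (eq_gauss omP _ E) (@eq_stick p f _ `|(n %% Q)%Z|%N) -?cardF //.
by move: uA; rewrite expn0 mul1n.
Qed.

End LocalBound.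

(** * Upper bounds, by passing to inverses of Gauss sums *)

Section InverseBound.
Variables (F : finFieldType) (p f : nat).
Hypotheses (p_pr : prime p) (pF : p \in [pchar F]) (f_gt0 : (0 < f)%N).
Hypothesis cardF : #|F| = (p ^ f)%N.
Local Notation Q := #|F|.-1.
Variables (psi om : F -> algC) (theta : algC) (w : F).
Hypotheses (psiP : addChar psi) (omP : genMulChar om).
Hypotheses (thetaP : theta ^+ Q = p%:R) (pw : Q.-primitive_root w).

Lemma gauss_neq0 n : gauss psi om n != 0.
Proof.
have q0 : (#|F|%:R : algC) != 0 by rewrite pnatr_eq0 -lt0n ltnW ?finNzRing_gt1.
have [Qn|Qn] := boolP (Q%:Z %| n)%Z.
  by rewrite gauss0 // oppr_eq0 oner_eq0.
apply/eqP => g0; have := gaussN omP psiP Qn; rewrite g0 mul0r.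
by case=> /eqP; rewrite eq_sym ?oppr_eq0 (negPf q0).
Qed.

Lemma card_gauss_inv_Aint n : #|F|%:R / gauss psi om n \in Aint.
Proof.
have psiA x : psi x \in Aint by apply: addChar_Aint.
have g0 := gauss_neq0 n.
have [Qn|Qn] := boolP (Q%:Z %| n)%Z.
  by rewrite gauss0 // invrN1 mulrN1 rpredN Aint_Cnat.
have [E|E] := gaussN omP psiP Qn.
  by rewrite -E mulrC mulKf // gauss_Aint.
by rewrite -[#|F|%:R]opprK -E mulNr mulrC mulKf // rpredN gauss_Aint.
Qed.

(** For a nontrivial character, [q] is [theta] to the power [stick n + stick (- n)], so up to sign
    this quotient is [g(-n) / theta ^+ stick (- n)], to which the lower bound applies. *)
Lemma gauss_inv_local_bound n : exists2 u, hornerz u w^-1 != 0 &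
  hornerz u (om w) * ((gauss psi om n)^-1 * theta ^+ stick p f n) \in Aint.
Proof.
have g0 := gauss_neq0 n; have t0 : theta != 0 := theta_neq0 p_pr thetaP.
have [Qn|Qn] := boolP (Q%:Z %| n)%Z.
  exists 1; rewrite !hornerz1 ?oner_eq0 // mul1r gauss0 // invrN1 mulN1r rpredN.
  by rewrite rpredX // (theta_Aint thetaP).
have [u uw uA] := gauss_local_bound p_pr pF f_gt0 cardF psiP omP thetaP pw (- n).
exists u => //.
have St : #|F|%:R = theta ^+ stick p f n * theta ^+ stick p f (- n) :> algC.
  by rewrite -exprD stickN -?cardF // mulnC exprM thetaP cardF natrX.
have [] := gaussN omP psiP Qn; rewrite St => E; last first.
  move/eqP: E; rewrite -eqr_oppLR -mulrN => /eqP E.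
  have -> : (gauss psi om n)^-1 * theta ^+ stick p f n
      = - gauss psi om (- n) / theta ^+ stick p f (- n).
    by apply: (mulfI g0); rewrite mulVKf // mulrA E mulfK // expf_neq0.
  by rewrite mulNr mulrN rpredN mulrA.
have -> : (gauss psi om n)^-1 * theta ^+ stick p f n
    = gauss psi om (- n) / theta ^+ stick p f (- n).
  by apply: (mulfI g0); rewrite mulVKf // mulrA E mulfK // expf_neq0.
by rewrite mulrA.
Qed.

Lemma gauss_quot_local_bound (I : finType) (n1 n2 m1 m2 : I -> int) :
  exists2 u, hornerz u w^-1 != 0 &
  hornerz u (om w) *
    (\prod_i (gauss psi om (n1 i) * gauss psi om (n2 i)
              / (gauss psi om (m1 i) * gauss psi om (m2 i)))
     * (theta ^+ (\sum_i (stick p f (m1 i) + stick p f (m2 i)))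
        / theta ^+ (\sum_i (stick p f (n1 i) + stick p f (n2 i))))) \in Aint.
Proof.
rewrite !expr_sum -prodf_div -big_split /=.
apply: (big_ind (fun y => exists2 u, hornerz u w^-1 != 0 & hornerz u (om w) * y \in Aint)).
- by exists 1; rewrite !hornerz1 ?oner_eq0 // mulr1.
- move=> x y [u u0 ux] [v v0 vy]; exists (u * v); rewrite hornerzM ?mulf_neq0 //.
  by rewrite mulrACA rpredM.
move=> i _.
have [u1 u10 u1A] := gauss_local_bound p_pr pF f_gt0 cardF psiP omP thetaP pw (n1 i).
have [u2 u20 u2A] := gauss_local_bound p_pr pF f_gt0 cardF psiP omP thetaP pw (n2 i).
have [u3 u30 u3A] := gauss_inv_local_bound (m1 i).
have [u4 u40 u4A] := gauss_inv_local_bound (m2 i).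
exists (u1 * u2 * u3 * u4); rewrite !hornerzM ?mulf_neq0 //.
have AM (x y : algC) : x \in Aint -> y \in Aint -> x * y \in Aint by apply: rpredM.
have := AM _ _ (AM _ _ u1A u2A) (AM _ _ u3A u4A).
set y := (X in X \in _ -> _); set z := (X in _ -> X \in _).
suff -> : z = y by []; rewrite /y /z !exprD; field.
by rewrite !gauss_neq0 !expf_neq0 // (theta_neq0 p_pr thetaP).
Qed.

End InverseBound.

(** * Changing the generator, or equivalently the prime above [p] *)

Section ChangeGenerator.
Variables (F : finFieldType) (psi om : F -> algC).
Hypothesis omP : genMulChar om.
Local Notation Q := #|F|.-1.

Lemma genMulChar_coprimeX k : coprime k Q -> genMulChar (fun x => om x ^+ k).
Proof.
move=> ckQ; case: omP => om1 omM omQ; split=> [|x y x0 y0|n omn].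
- by rewrite om1 expr1n.
- by rewrite omM // exprMn.
rewrite -(@Gauss_dvdr _ k) 1?coprime_sym //; apply: omQ => x x0.
by rewrite exprM omn.
Qed.

(** Another prime above [p] amounts to [om ^+ k] in place of [om]; the Gauss sums stay the same once
    their arguments are multiplied by the inverse [k']. This is the source of the multipliers [k] in
    [isMinLambda]. *)
Lemma gauss_coprimeX k k' n : (k * k' = 1 %[mod Q])%N ->
  gauss psi (fun x => om x ^+ k) (k'%:Z * n) = gauss psi om n.
Proof.
move=> kk'; transitivity (gauss psi om ((k * k')%N%:Z * n)).
  apply: eq_bigr => x x0; congr (_ * _).
  by rewrite -[om x ^+ k]/(om x ^ k) exprz_exp mulrA PoszM.
by apply: eq_gauss => //; rewrite -modzMml modz_nat kk' -modz_nat modzMml mul1r.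
Qed.

End ChangeGenerator.

(** * Divisibility of the sum over [m] by [1 - q] *)

Section Mellin.
Variables (F : finFieldType) (om : F -> algC).
Hypothesis omP : genMulChar om.
Local Notation Q := #|F|.-1.

(** Mellin transforms of functions with algebraic integer values: a class closed under products,
    whose members have sums over [m] divisible by [1 - q]. *)
Definition mellin (h : nat -> algC) : Prop := exists2 c : F -> algC,
  forall x, c x \in Aint & forall m, h m = \sum_(x | x != 0) c x * om x ^+ m.

Lemma mellin_omega c x : c \in Aint -> x != 0 -> mellin (fun m => c * om x ^+ m).
Proof.
move=> cA x0; exists (fun y => if y == x then c else 0) => [y|m].
  by case: ifP.
rewrite (bigD1 x) //= eqxx big1 ?addr0 // => y /andP[_ /negPf ->].
by rewrite mul0r.
Qed.

(** The coefficients of the product are the multiplicative convolution. *)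
Lemma mellinM h1 h2 : mellin h1 -> mellin h2 -> mellin (fun m => h1 m * h2 m).
Proof.
move=> [c1 c1A h1E] [c2 c2A h2E].
exists (fun z => \sum_(x | x != 0) c1 x * c2 (x^-1 * z)) => [z|m].
  by apply: rpred_sum => x _; rewrite rpredM.
rewrite h1E h2E mulr_suml.
under [RHS]eq_bigr => z _ do rewrite mulr_suml.
rewrite [RHS]exchange_big /=; apply: eq_bigr => x x0; rewrite mulr_sumr.
rewrite [RHS](reindex_onto (fun y => x * y) (fun y => x^-1 * y)) /=; last first.
  by move=> y _; rewrite mulVKf.
apply: eq_big => y; first by rewrite mulKf // eqxx andbT mulf_eq0 (negPf x0).
move=> y0; rewrite mulKf // (genMulChar_mulChar omP).2 // exprMn; ring.
Qed.

Lemma mellin_prod (I : finType) (h : I -> nat -> algC) :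
  (forall i, mellin (h i)) -> mellin (fun m => \prod_i h i m).
Proof.
move=> hM; suff H (s : seq I) : mellin (fun m => \prod_(i <- s) h i m) by apply: H.
elim: s => [|i s IHs].
  have [c cA cE] := mellin_omega (Aint1) (oner_neq0 F).
  exists c => // m; rewrite big_nil -cE (genMulChar_mulChar omP).1 expr1n mulr1 //.
have [c cA cE] := mellinM (hM i) IHs.
by exists c => // m; rewrite big_cons cE.
Qed.

Lemma mellin_gauss psi n : addChar psi -> mellin (fun m => gauss psi om (m%:Z + n)).
Proof.
(* The coefficient at 0 is set to 0 since it must be integral while [om 0] is arbitrary. *)
move=> psiP; exists (fun x => if x == 0 then 0 else om x ^ n * psi x) => [x|m].
  by case: eqP => // /eqP x0; rewrite rpredM ?genMulChar_expz_Aint ?addChar_Aint.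
apply: eq_bigr => x x0; rewrite (negPf x0) expfzDr ?genMulChar_neq0 //.
by rewrite -[om x ^ m]/(om x ^+ m); ring.
Qed.

Lemma mellin_gaussN psi n : addChar psi -> mellin (fun m => gauss psi om (- m%:Z - n)).
Proof.
move=> psiP; exists (fun x => if x == 0 then 0 else om x ^ n * psi x^-1) => [x|m].
  by case: eqP => // /eqP x0; rewrite rpredM ?genMulChar_expz_Aint ?addChar_Aint.
rewrite /gauss (reindex_inj (@invr_inj F)) /=.
apply: eq_big => x; first by rewrite invr_eq0.
rewrite invr_eq0 => x0; rewrite (negPf x0) (mulCharV (genMulChar_mulChar omP)) //.
rewrite exprz_inv opprD !opprK expfzDr ?genMulChar_neq0 //.
by rewrite -[om x ^ m]/(om x ^+ m); ring.
Qed.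

Lemma mellin_sum h : mellin h -> exists2 r, r \in Aint & \sum_(m < Q) h m = (1 - #|F|%:R) * r.
Proof.
move=> [c cA hE].
have S x : x != 0 -> exists2 r, r \in Aint & \sum_(m < Q) om x ^+ m = (1 - #|F|%:R) * r.
  move=> x0; have [ox1|ox1] := eqVneq (om x) 1.
    exists (-1); first by rewrite rpredN.
    under eq_bigr => m _ do rewrite ox1 expr1n.
    rewrite sumr_const card_ord -subn1 natrB ?(ltnW (finNzRing_gt1 F)) //; ring.
  exists 0 => //; have := subrX1 (om x) Q; rewrite genMulChar_expQ // subrr mulr0.
  by move=> /esym/eqP; rewrite mulf_eq0 subr_eq0 (negPf ox1) => /eqP.
under eq_bigr => m _ do rewrite hE.
rewrite exchange_big /=.
apply: (big_ind (fun y => exists2 r, r \in Aint & y = (1 - #|F|%:R) * r)).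
- by exists 0; rewrite ?mulr0.
- by move=> _ _ [r rA ->] [s sA ->]; exists (r + s); rewrite ?rpredD ?mulrDr.
move=> x x0; have [r rA rE] := S x x0; exists (c x * r); first by rewrite rpredM.
by rewrite -mulr_sumr rE mulrCA.
Qed.

End Mellin.

(** * [Lambda] and the comparison of exponents *)

Section LambdaTheory.
Variable d : nat.
Implicit Types (a b : 'I_d -> rat) (x : rat).

Lemma fracDz x (n : int) : Defs.frac (x + n%:~R) = Defs.frac x.
Proof.
rewrite /Defs.frac floorDrz ?intr_int // intrKfloor intrD; ring.
Qed.

Lemma frac_itv x : 0 <= Defs.frac x <= 1.
Proof.
rewrite /Defs.frac subr_ge0 floor_le /= lerBlDl addrC.
by have := floorD1_gt x; rewrite intrD addrC => /ltW.
Qed.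

(** Periodicity in [x] brings every argument into the interval over which the minimum is taken. *)
Lemma Lambda_frac a b x : Lambda a b x = Lambda a b (Defs.frac x).
Proof.
apply: eq_bigr => i _.
rewrite -(fracDz (Defs.frac x + a i) (Num.floor x)).
rewrite -(fracDz (- Defs.frac x - b i) (- Num.floor x)) intrN.
by congr (Defs.frac _ - _ + Defs.frac _ - _); rewrite /Defs.frac; ring.
Qed.

Lemma Lambda_int a b x : Lambda a b x \is a Num.int.
Proof.
apply: rpred_sum => i _; rewrite /Defs.frac.
set c1 := (Num.floor _)%:~R; set c2 := (Num.floor _)%:~R.
set c3 := (Num.floor _)%:~R; set c4 := (Num.floor _)%:~R.
have -> : x + a i - c1 - (a i - c2) + (- x - b i - c3) - (- b i - c4) = c2 - c1 + (c4 - c3).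
  ring.
by rewrite rpredD // rpredB // intr_int.
Qed.

Lemma Lambda0 a b : Lambda a b 0 = 0.
Proof. by apply: big1 => i _; rewrite oppr0 !add0r subrr add0r subrr. Qed.

(** Values of [Lambda] are integers, and its value 0 at [x = 0], [k = 1] makes the minimum
    nonpositive. So the floor in the theorem is [lam] itself. *)
Lemma isMinLambda_nat a b lam : isMinLambda a b (- lam) -> exists L : nat, lam = L%:R.
Proof.
move=> [[k [x [_ _ E]]] minL].
apply/natrP; rewrite natrEint -[lam]opprK -E rpredN Lambda_int /= oppr_ge0 E.
rewrite -(Lambda0 (fun i => 1%:~R * a i) (fun i => 1%:~R * b i)).
by apply: minL; rewrite ?lexx ?ler01 ?coprimezE ?coprime1n.
Qed.

Lemma denq_dvd (Q : nat) x : Q%:R * x \is a Num.int -> (`|denq x| %| Q)%N.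
Proof.
move=> /intrP[m E]; rewrite -(@Gauss_dvdr _ `|numq x|); last first.
  by rewrite coprime_sym coprime_num_den.
have D : (numq x * Q%:Z) = m * denq x.
  apply: (@intr_inj rat); rewrite !intrM -E -pmulrn numqE; ring.
suff : (denq x %| numq x * Q%:Z)%Z by rewrite dvdzE abszM.
by rewrite D dvdz_mull.
Qed.

Lemma commonDen_dvd (Q : nat) a b :
    (forall i, Q%:R * a i \is a Num.int) -> (forall j, Q%:R * b j \is a Num.int) ->
  (commonDen a b %| Q)%N.
Proof.
move=> aQ bQ; apply: (big_ind (fun n => (n %| Q)%N)) => [|x y xQ yQ|i _]; rewrite ?dvd1n //.
  by rewrite dvdn_lcm xQ.
by rewrite dvdn_lcm !denq_dvd.
Qed.

Variables p f : nat.
Hypotheses (p_pr : prime p) (f_gt0 : (0 < f)%N).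
Local Notation Q := (p ^ f).-1.

(** By [stick_frac], the [j]-th terms of the exponents are the fractional parts that make up
    [Lambda] with multiplier [p ^ j * k], at [p ^ j * k * m / Q]. *)
Lemma stick_Lambda a b (A B : 'I_d -> int) (k m : nat) :
    (forall i, Q%:R * a i = (A i)%:~R) -> (forall i, Q%:R * b i = (B i)%:~R) ->
  (\sum_(i < d) (stick p f (k%:Z * (m%:Z + A i)) + stick p f (k%:Z * (- m%:Z - B i))))%:R
  - (\sum_(i < d) (stick p f (k%:Z * A i) + stick p f (k%:Z * - B i)))%:R
  = Q%:R * \sum_(j < f)
      Lambda (fun i => (p ^ j * k)%N%:~R * a i) (fun i => (p ^ j * k)%N%:~R * b i)
             ((p ^ j * k)%N%:R * (m%:R / Q%:R)) :> rat.
Proof.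
move=> aQ bQ; rewrite !natr_sum -sumrB /Lambda exchange_big mulr_sumr /=.
have Q0 : (Q%:R : rat) != 0 by rewrite pnatr_eq0 -lt0n Q_gt0.
apply: eq_bigr => i _; rewrite !natrD !stick_frac // -!mulrDr -mulrBr -!big_split -sumrB /=.
congr (_ * _); apply: eq_bigr => j _.
rewrite -[((p ^ j * k)%N)%:~R]/((p ^ j * k)%N%:R) natrM !intrM !intrD !intrN -aQ -bQ.
rewrite -!pmulrn.
set P : rat := (p ^ j)%:R; set K : rat := k%:R; set M : rat := m%:R; set q : rat := Q%:R.
have -> : P * (K * (M + q * a i) / q) = P * K * (M / q) + P * K * a i by field.
have -> : P * (K * (- M - q * b i) / q) = - (P * K * (M / q)) - P * K * b i by field.
have -> : P * (K * (q * a i) / q) = P * K * a i by field.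
have -> : P * (K * - (q * b i) / q) = - (P * K * b i) by field.
ring.
Qed.

(** Each of the [f] values of [Lambda] in [stick_Lambda] is at least [- L]: the multiplier
    [p ^ j * k] is prime to [Q], hence to the common denominator, which divides [Q]. *)
Lemma stick_quot_bound a b (A B : 'I_d -> int) (k m L : nat) :
    (forall i, Q%:R * a i = (A i)%:~R) -> (forall i, Q%:R * b i = (B i)%:~R) ->
    coprime k Q -> isMinLambda a b (- L%:R) ->
  (\sum_(i < d) (stick p f (k%:Z * A i) + stick p f (k%:Z * - B i))
   <= f * Q * L
      + \sum_(i < d) (stick p f (k%:Z * (m%:Z + A i)) + stick p f (k%:Z * (- m%:Z - B i))))%N.
Proof.
move=> aQ bQ ckQ [_ minL]; rewrite -(ler_nat rat) natrD -lerBlDr -lerN2 opprB.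
rewrite (stick_Lambda _ _ aQ bQ) mulnAC mulnC !natrM -mulrN.
apply: ler_wpM2l; first exact: ler0n.
have -> : - (f%:R * L%:R) = \sum_(j < f) - L%:R :> rat.
  by rewrite sumr_const card_ord mulNrn mulr_natl.
apply: ler_sum => j _; rewrite Lambda_frac; apply: minL; last exact: frac_itv.
apply: (@coprimez_dvdr _ Q); last first.
  by rewrite coprimezE /= coprimeMl ckQ andbT coprime_sym coprime_Qp.
rewrite /= ; apply: commonDen_dvd => i; by rewrite ?aQ ?bQ intr_int.
Qed.

End LambdaTheory.

(** * Combining the local bounds with the divisibility by [1 - q] *)

Theorem mainTheorem6 (F : finFieldType) (psi om : F -> algC) (d : nat)
    (a b : 'I_d -> rat) (lam : rat) (t : F) :
  addChar psi -> genMulChar om ->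
  (forall i j, a i - b j \isn't a Num.int) ->
  (forall i, (#|F|.-1)%:R * a i \is a Num.int) ->
  (forall j, (#|F|.-1)%:R * b j \is a Num.int) ->
  isMinLambda a b (- lam) ->
  t != 0 ->
  (#|F|%:R : algC) ^ (Num.floor lam) * Hq psi om a b t \in Aint.
Proof.
move=> psiP omP _ aQ bQ minL t0.
have [[p f] /= [p_pr pF f_gt0 cardF]] := finField_card_pexp F.
have [w pw] := finField_prim_root F.
have Q0 := finField_card_gt0 F.
have [L Dlam] := isMinLambda_nat minL; rewrite Dlam in minL *.
have -> : Num.floor (L%:R : rat) = L by rewrite pmulrn intrKfloor.
rewrite -[_ ^ (L : int)]/(_ ^+ L); set q : algC := #|F|%:R; set Q := #|F|.-1 in aQ bQ Q0 pw *.
have q0 : q != 0 by rewrite pnatr_eq0 -lt0n ltnW ?finNzRing_gt1.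
pose A i := qbarMul F (a i); pose B i := qbarMul F (b i).
have DA i : Q%:R * a i = (A i)%:~R by rewrite [RHS]floorK.
have DB i : Q%:R * b i = (B i)%:~R by rewrite [RHS]floorK.
(* Powers of this root of [p] express all the exponents [stick], which count in units of [1 / Q]. *)
pose theta : algC := Q.-root p%:R.
have thetaP : theta ^+ Q = p%:R by rewrite rootCK.
have theta0 : theta != 0 := theta_neq0 p_pr thetaP.
have thetaA : theta \in Aint := theta_Aint thetaP.
have g0 := gauss_neq0 psiP omP.
have qA : q \in Aint by rewrite /q rpred_nat.
set t' := (-1) ^+ d * t; have t'0 : t' != 0 by rewrite mulf_neq0 // signr_eq0.
pose T m := \prod_(i < d)
  (gauss psi om (m%:Z + A i) * gauss psi om (- m%:Z - B i)
   / (gauss psi om (A i) * gauss psi om (- B i))).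
(* The [2 d] denominators of [T m] do not depend on [m]; one factor [q] clears each of them. *)
pose C := \prod_(i < d) (q / gauss psi om (A i) * (q / gauss psi om (- B i))).
have CA : C \in Aint by apply: rpred_prod => i _; rewrite rpredM // card_gauss_inv_Aint.
have DT m : q ^+ (2 * d) * T m =
    C * \prod_(i < d) (gauss psi om (m%:Z + A i) * gauss psi om (- m%:Z - B i)).
  rewrite exprM -[X in _ ^+ X]card_ord -prodr_const -!big_split /=.
  by apply: eq_bigr => i _; field; rewrite !g0.
have TA m : q ^+ (2 * d) * T m \in Aint.
  rewrite DT rpredM //; apply: rpred_prod => i _.
  by rewrite rpredM // gauss_Aint // => x; apply: addChar_Aint.
have qp n : p%:R ^+ (f * n) = q ^+ n :> algC by rewrite exprM -natrX -cardF.
have qTA m : q ^+ L * T m \in Aint.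
  (* The local bounds evaluate their multipliers at [w^-1] and [om w], so these form the pair given
     to [Aint_local]. *)
  have pwV : Q.-primitive_root w^-1.
    have -> : w^-1 = w ^+ Q.-1.
      apply: (mulfI (prim_root_neq0 pw)).
      by rewrite divff ?(prim_root_neq0 pw) // -exprS prednK // prim_expr_order.
    by rewrite prim_root_exp_coprime // coprimePn.
  apply: (Aint_local pF (n := f * (2 * d)) pwV (genMulChar_prim omP pw)).
    by rewrite qp mulrCA rpredM // rpredX.
  move=> k ckQ; have [k' ck'Q kk'] := coprime_modinv Q0 ckQ.
  have omkP := genMulChar_coprimeX omP ckQ.
  have [u u0 uA] := gauss_quot_local_bound p_pr pF f_gt0 cardF psiP omkP thetaP pw
    (fun i => k'%:Z * (m%:Z + A i)) (fun i => k'%:Z * (- m%:Z - B i))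
    (fun i => k'%:Z * A i) (fun i => k'%:Z * - B i).
  exists u => //.
  have := stick_quot_bound p_pr f_gt0 m (a := a) (b := b) (A := A) (B := B) (k := k') (L := L).
  rewrite -cardF => /(_ DA DB ck'Q minL); move: uA.
  set D := (X in theta ^+ X / _); set N := (X in _ / theta ^+ X) => uA DN.
  have -> : T m = \prod_(i < d)
      (gauss psi (fun x => om x ^+ k) (k'%:Z * (m%:Z + A i))
       * gauss psi (fun x => om x ^+ k) (k'%:Z * (- m%:Z - B i))
       / (gauss psi (fun x => om x ^+ k) (k'%:Z * A i)
          * gauss psi (fun x => om x ^+ k) (k'%:Z * - B i))).
    by apply: eq_bigr => i _; rewrite !(gauss_coprimeX psi omP _ kk').
  (* Here [q ^+ L] is [theta ^+ (f * Q * L)]; by [DN] it covers the deficit [D - N] and leaves an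
     integral power of [theta]. *)
  have -> : q ^+ L = theta ^+ D / theta ^+ N * theta ^+ (f * Q * L + N - D).
    have -> : q ^+ L = theta ^+ (f * Q * L).
      by rewrite -(mulnC Q) -mulnA exprM thetaP qp.
    apply: (mulfI (expf_neq0 N theta0)).
    rewrite mulrA [theta ^+ N * (_ / _)]mulrC divfK ?expf_neq0 //.
    by rewrite -!exprD subnKC // addnC.
  have R4 (x y e P : algC) : x * (y * e * P) = (x * (P * y)) * e by ring.
  by rewrite R4 rpredM // rpredX.
have [r rA rE] : exists2 r, r \in Aint &
    \sum_(m < Q) (q ^+ (2 * d) * T m) * om t' ^+ m = (1 - q) * r.
  have := mellin_sum omP (mellinM omP (mellin_prod omP (fun i : 'I_d =>
    mellinM omP (mellin_gauss omP (A i) psiP) (mellin_gaussN omP (B i) psiP)))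
    (mellin_omega om CA t'0)).
  case=> r rA rE; exists r => //; rewrite -rE; apply: eq_bigr => m _.
  by rewrite DT [C * _]mulrC -mulrA.
have q1 : 1 - q != 0 by rewrite subr_eq0 eq_sym pnatr_eq1 gtn_eqF ?finNzRing_gt1.
have DH : Hq psi om a b t = (1 - q)^-1 * \sum_(m < Q) T m * om t' ^+ m by [].
(* With [r = p ^ (f - 1)] the factor [1 - p r] is [1 - q], which cancels the denominator of [Hq];
   the power of [p] is [q ^+ (2 * d)]. *)
apply: (@Aint_of_coprime_p p (f * (2 * d)) (p%:R ^+ f.-1)).
- by rewrite rpredX // Aint_Cnat.
- rewrite -exprS prednK // -[f]muln1 qp expr1 mulrCA DH mulVKf // mulr_sumr.
  apply: rpred_sum => m _; rewrite mulrA rpredM // -mulCharX //; last exact: genMulChar_mulChar.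
  by rewrite -[om _]expr1 (genMulChar_expz_Aint omP 1) // expf_neq0.
rewrite qp mulrCA rpredM ?rpredX // DH mulrCA mulr_sumr.
under eq_bigr => m _ do rewrite mulrA.
by rewrite rE mulKf.
Qed.
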